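(* Let $A$ be a commutative ring with unit, let $I,J$ be ideals of $A$ and let $a\in A$. There is an exact sequence of $A$-modules $$0\longrightarrow K^{I\cap J}_a \xrightarrow{\eta_a} K_a^I\oplus K_a^J \xrightarrow{\alpha_a} K_a^{I+J}\xrightarrow{\delta_a} C_a^{I\cap J}\xrightarrow{\beta_a} C_a^I\oplus C_a^J\xrightarrow{\gamma_a} C_a^{I+J}\longrightarrow 0$$ where \begin{itemize} \item $\eta_a\bigl(c+(I\cap J)\bigr)=(c+I,\,c+J)$, \item $\alpha_a(d+I,\,b+J)=d-b+(I+J)$, \item $\beta_a\bigl(d+(I\cap J+aA)\bigr)=\bigl(d+(I+aA),\,d+(J+aA)\bigr)$, \item $\gamma_a\bigl(d+(I+aA),\,b+(J+aA)\bigr)=d-b+(I+J+aA)$, \item $\delta_a\bigl(c+(I+J)\bigr)=j+(I\cap J+aA)$, where $i\in I$ and $j\in J$ are such that $ac=i+j$. \end{itemize}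
   Context: For an ideal $L$ of $A$ and $a\in A$, $\mu_a^L\colon A/L\to A/L$ is the $A$-module homomorphism $x+L\mapsto ax+L$. Its kernel is $K_a^L:=\ker(\mu_a^L)=(L:a)/L$, where $(L:a)=\{x\in A\mid ax\in L\}$, and its cokernel is $C_a^L:=\operatorname{coker}(\mu_a^L)=(A/L)/a(A/L)$, identified with $A/(L+aA)$. Here $I\cap J+aA$ means $(I\cap J)+aA$. *)

(* Defs.v *)
From HB Require Import structures.
From mathcomp Require Import all_boot all_algebra generic_quotient ring_quotient.
From mathcomp Require Import boolp.

Set Implicit Arguments.
Unset Strict Implicit.
Unset Printing Implicit Defensive.

Import GRing.Theory.

Local Open Scope ring_scope.
Local Open Scope quotient_scope.

(* Submodules are `submodClosed` predicates. Ideals of A are submodules of the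
   regular module A^o: unlike the `idealr` of ring_quotient this allows the unit
   ideal and the zero ring, which is needed since I + J may be all of A. *)
Notation ideal A := (submodClosed A^o).

Section Submodules.
Variables (R : pzRingType) (V : lmodType R).

Section Binary.
Variables L M : submodClosed V.

Definition capsm_pred : {pred V} := [pred x | (x \in L) && (x \in M)].

Fact capsm_closed : submod_closed capsm_pred.
Proof.
split=> [|a x y]; rewrite !inE ?rpred0 // => /andP[xL xM] /andP[yL yM].
by rewrite !rpredD ?rpredZ.
Qed.
HB.instance Definition _ := GRing.isSubmodClosed.Build R V capsm_pred capsm_closed.

Definition addsm_pred : {pred V} :=
  [pred x | `[< exists l m, [/\ l \in L, m \in M & x = l + m] >]].

Fact addsm_closed : submod_closed addsm_pred.
Proof.
split=> [|a x y]; rewrite !inE.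
  by apply/asboolP; exists 0, 0; rewrite !rpred0 addr0.
move=> /asboolP[l [m [lL mM ->]]] /asboolP[l' [m' [l'L m'M ->]]].
apply/asboolP; exists (a *: l + l'), (a *: m + m').
by rewrite !rpredD ?rpredZ // scalerDr addrACA.
Qed.
HB.instance Definition _ := GRing.isSubmodClosed.Build R V addsm_pred addsm_closed.

Definition capsm : submodClosed V := capsm_pred.
Definition addsm : submodClosed V := addsm_pred.
End Binary.

Section SubmoduleType.
Variable L : submodClosed V.

Definition submodule : Type := {x : V | x \in L}.
HB.instance Definition _ := SubChoice.on submodule.
HB.instance Definition _ := [SubChoice_isSubLmodule of submodule by <:].
End SubmoduleType.

Section QuotientModule.
Variable L : submodClosed V.

Definition zmod_of_submod : zmodClosed V :=
  HB.pack (GRing.SubmodClosed.sort L)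
    (GRing.isZmodClosed.Build V (GRing.SubmodClosed.sort L)
       (GRing.submod_closedB (submodClosedP L))).

Definition quomod : Type := Quotient.quot zmod_of_submod.
HB.instance Definition _ := ZmodQuotient.on quomod.

Definition cls (x : V) : quomod := \pi_quomod x.

Lemma cls_eq x y : (cls x == cls y) = (x - y \in L).
Proof. by rewrite /cls -Quotient.idealrBE. Qed.

Lemma reprK_cls (x : quomod) : cls (repr x) = x.
Proof. exact: reprK. Qed.

Lemma clsP (x : quomod) : exists y, x = cls y.
Proof. by exists (repr x); rewrite reprK_cls. Qed.

Fact cls_is_zmod_morphism : zmod_morphism cls.
Proof. by move=> x y; rewrite /cls raddfB. Qed.
HB.instance Definition _ :=
  GRing.isZmodMorphism.Build V quomod cls cls_is_zmod_morphism.

Definition quoscale (a : R) (x : quomod) : quomod := cls (a *: repr x).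

Lemma quoscale_cls a x : quoscale a (cls x) = cls (a *: x).
Proof.
by apply/eqP; rewrite cls_eq -scalerBr rpredZ // -cls_eq reprK_cls.
Qed.

Fact quoscaleA a b x : quoscale a (quoscale b x) = quoscale (a * b) x.
Proof. by have [y ->] := clsP x; rewrite !quoscale_cls scalerA. Qed.
Fact quoscale1 : left_id 1 quoscale.
Proof. by move=> x; have [y ->] := clsP x; rewrite quoscale_cls scale1r. Qed.
Fact quoscaleDr : right_distributive quoscale +%R.
Proof.
move=> a x y; have [x' ->] := clsP x; have [y' ->] := clsP y.
by rewrite -raddfD !quoscale_cls scalerDr raddfD.
Qed.
Fact quoscaleDl x : {morph quoscale^~ x : a b / a + b}.
Proof.
by move=> a b; have [y ->] := clsP x; rewrite !quoscale_cls scalerDl raddfD.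
Qed.
HB.instance Definition _ := GRing.Zmodule_isLmodule.Build R quomod
  quoscaleA quoscale1 quoscaleDr quoscaleDl.

Fact cls_is_scalable : scalable cls.
Proof. by move=> a x; rewrite -quoscale_cls. Qed.
HB.instance Definition _ :=
  GRing.isScalable.Build R V quomod _ cls cls_is_scalable.
End QuotientModule.
End Submodules.

Section Linear.
Variables (R : pzRingType) (U V : lmodType R) (f : {linear U -> V}).

Definition kersm_pred : {pred U} := [pred x | f x == 0].

Fact kersm_closed : submod_closed kersm_pred.
Proof.
split=> [|a x y]; rewrite !inE ?raddf0 // => /eqP fx /eqP fy.
by rewrite linearP fx fy scaler0 addr0.
Qed.
HB.instance Definition _ := GRing.isSubmodClosed.Build R U kersm_pred kersm_closed.

Definition imsm_pred : {pred V} := [pred y | `[< exists x, f x = y >]].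

Fact imsm_closed : submod_closed imsm_pred.
Proof.
split=> [|a x y]; rewrite !inE; first by apply/asboolP; exists 0; rewrite raddf0.
move=> /asboolP[x' <-] /asboolP[y' <-]; apply/asboolP.
by exists (a *: x' + y'); rewrite linearP.
Qed.
HB.instance Definition _ := GRing.isSubmodClosed.Build R V imsm_pred imsm_closed.

Definition kersm : submodClosed U := kersm_pred.
Definition imsm : submodClosed V := imsm_pred.
Definition ker : lmodType R := submodule kersm.
Definition coker : lmodType R := quomod imsm.
End Linear.

Definition exact_at (R : pzRingType) (U V W : lmodType R)
  (f : {linear U -> V}) (g : {linear V -> W}) : Prop := imsm f =i kersm g.

Section KerCoker.
Variables (A : comPzRingType) (a : A).

Definition prid_pred : {pred A^o} := [pred x : A | `[< exists b : A, x = a * b >]].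

Fact prid_closed : submod_closed prid_pred.
Proof.
split=> [|b x y]; rewrite !inE; first by apply/asboolP; exists 0; rewrite mulr0.
move=> /asboolP[x' ->] /asboolP[y' ->]; apply/asboolP.
by exists (b * x' + y'); rewrite mulrDr mulrCA.
Qed.
HB.instance Definition _ := GRing.isSubmodClosed.Build A A^o prid_pred prid_closed.
Definition prid : ideal A := prid_pred.

Variable L : ideal A.

Definition mulq (x : quomod L) : quomod L := a *: x.
Fact mulq_is_linear : linear mulq.
Proof. by move=> b x y; rewrite /mulq scalerDr !scalerA mulrC. Qed.
HB.instance Definition _ :=
  GRing.isLinear.Build A (quomod L) (quomod L) _ mulq mulq_is_linear.
Definition mu : {linear quomod L -> quomod L} := mulq.

Lemma mu_cls (x : A) : mu (cls L x) = cls L (a * x).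
Proof. exact: quoscale_cls. Qed.

Definition K : lmodType A := ker mu.
Definition C : lmodType A := coker mu.

(* The inclusion of K = (L : a)/L into A/L. *)
Definition Kval : {linear K -> quomod L} :=
  (val : {linear submodule (kersm mu) -> quomod L}).

Lemma Kval_inj : injective Kval.
Proof. exact: val_inj. Qed.

Lemma K_cls (x : A) : (exists y : K, Kval y = cls L x) <-> a * x \in L.
Proof.
rewrite -[X in X \in L]subr0 -cls_eq raddf0 -mu_cls; split=> [[y <-]|h].
  exact: (valP (y : submodule (kersm mu))).
by exists (Sub (cls L x) h : submodule (kersm mu)); exact: SubK.
Qed.

(* The identification of A/(L + aA) with C = (A/L)/a(A/L). *)
Definition coker_id (x : quomod (addsm L prid)) : C := cls (imsm mu) (cls L (repr x)).

Lemma coker_clsE (x y : A) :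
  (cls (imsm mu) (cls L x) == cls (imsm mu) (cls L y))
  = (cls (addsm L prid) x == cls (addsm L prid) y).
Proof.
rewrite !cls_eq -raddfB; apply/asboolP/asboolP.
  case=> z; have [b ->] := clsP z; rewrite mu_cls => /esym/eqP.
  rewrite cls_eq => h; exists (x - y - a * b), (a * b).
  by rewrite h subrK; split=> //; apply/asboolP; exists b.
case=> l [m [lL /asboolP[b ->] e]]; exists (cls L b).
by apply/eqP; rewrite mu_cls e eq_sym cls_eq addrK.
Qed.

Lemma coker_id_cls (x : A) :
  coker_id (cls (addsm L prid) x) = cls (imsm mu) (cls L x).
Proof. by apply/eqP; rewrite coker_clsE reprK_cls. Qed.

Fact coker_id_is_linear : linear coker_id.
Proof.
move=> b x y; have [x' ->] := clsP x; have [y' ->] := clsP y.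
by rewrite -linearP !coker_id_cls !linearP.
Qed.
HB.instance Definition _ :=
  GRing.isLinear.Build A (quomod (addsm L prid)) C _ coker_id coker_id_is_linear.

Lemma coker_id_bij : bijective coker_id.
Proof.
pose g (z : C) : quomod (addsm L prid) := cls (addsm L prid) (repr (repr z)).
exists g => [x|z]; last by rewrite /g coker_id_cls !reprK_cls.
have [x' ->] := clsP x; apply/eqP.
by rewrite /g -coker_clsE coker_id_cls !reprK_cls.
Qed.
End KerCoker.

Arguments Kval {A a L}.

(* Main.v *)
(* Every map in the sequence is the graph of a linear relation between
   representatives in A: the relation is total, closed under linear combinations
   and relates 0 only to 0. For delta this says: if c ranges over a class modulo
   I + J and a c = i + j, then j is determined modulo I cap J + aA, since changing
   c by i0 + j0 changes j by a j0 up to I cap J. Exactness is then checked on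
   representatives. *)
Require Import Defs.
From HB Require Import structures.
From mathcomp Require Import all_boot all_algebra.
From mathcomp Require Import boolp.
From mathcomp Require Import ring.

Set Implicit Arguments.
Unset Strict Implicit.
Unset Printing Implicit Defensive.

Import GRing.Theory.
Local Open Scope ring_scope.

(** * Linear maps from linear relations, and membership in quotients *)

(** Choice picks a related value [f x] for each [x]. If also [G x u], the combination with
    coefficient -1 relates 0 to [f x - u], so [f x = u]; linearity of [f] is then closure of [G]
    under combinations. *)
Lemma linear_of_relation (R : pzRingType) (U V : lmodType R) (G : U -> V -> Prop) :
  (forall x, exists u, G x u) ->
  (forall b x y u v, G x u -> G y v -> G (b *: x + y) (b *: u + v)) ->
  (forall u, G 0 u -> u = 0) ->
  exists f : {linear U -> V}, forall x u, G x u -> f x = u.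
Proof.
move=> tot lin uniq0; have [f fG] := choice tot.
have fE x u : G x u -> f x = u.
  move=> xu; apply/eqP; rewrite -subr_eq0; apply/eqP/uniq0.
  by have := lin (-1) _ _ _ _ xu (fG x); rewrite !scaleN1r addNr addrC.
have flin : linear f by move=> b x y; apply: fE; apply: lin.
pose g : {linear U -> V} := HB.pack f (GRing.isLinear.Build R U V _ f flin).
by exists g.
Qed.

Lemma exact_atP (R : pzRingType) (U V W : lmodType R)
    (f : {linear U -> V}) (g : {linear V -> W}) :
  (forall u, g (f u) = 0) -> (forall v, g v = 0 -> exists u, f u = v) ->
  exact_at f g.
Proof.
move=> gf kerg v; apply/asboolP/eqP => [[u <-]|]; [exact: gf | exact: kerg].
Qed.

Lemma addsmP (R : pzRingType) (V : lmodType R) (L M : submodClosed V) (x : V) :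
  reflect (exists l m, [/\ l \in L, m \in M & x = l + m]) (x \in addsm L M).
Proof. exact: asboolP. Qed.

Lemma cls0P (R : pzRingType) (V : lmodType R) (L : submodClosed V) (x : V) :
  cls L x = 0 <-> x \in L.
Proof. by rewrite -[X in X \in L]subr0 -cls_eq raddf0; split=> /eqP. Qed.

Lemma clsE (R : pzRingType) (V : lmodType R) (L : submodClosed V) (x y : V) :
  cls L x = cls L y <-> x - y \in L.
Proof. by rewrite -cls_eq; split=> /eqP. Qed.

(** * Elements of kernels and cokernels through representatives in the ring *)

Section KernelsAndCokernels.
Variables (A : comPzRingType) (a : A).
Implicit Types L I J : ideal A.

(** Closure of submodules of [A^o], restated with ring multiplication in place of scaling, so that
    it applies to products in [A]. *)
Lemma idealMl L (b x : A) : x \in L -> b * x \in L.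
Proof. exact: (@rpredZ _ _ L b x). Qed.

Lemma ideal0 L : (0 : A) \in L.
Proof. exact: (@rpred0 _ L). Qed.

Lemma idealD L (x y : A) : x \in L -> y \in L -> x + y \in L.
Proof. exact: (@rpredD _ L x y). Qed.

Lemma idealN L (x : A) : (- x \in L) = (x \in L).
Proof.
by apply/idP/idP => /(idealMl (-1)); rewrite mulN1r // opprK.
Qed.

Lemma idealB L (x y : A) : x \in L -> y \in L -> x - y \in L.
Proof. by move=> xL yL; rewrite idealD ?idealN. Qed.

Lemma cls_lin L (b x y : A) : cls L (b * x + y) = b *: cls L x + cls L y.
Proof. exact: (linearP (cls L) b (x : A^o) (y : A^o)). Qed.

Lemma K_rep L (x : K a L) : exists2 c : A, Kval x = cls L c & a * c \in L.
Proof.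
have [c xc] := clsP (Kval x); exists c => //.
by apply/K_cls; exists x.
Qed.

Lemma K_mem L (x : K a L) (c : A) : Kval x = cls L c -> a * c \in L.
Proof. by move=> xc; apply/K_cls; exists x. Qed.

Lemma K_lift L (c : A) : a * c \in L -> exists x : K a L, Kval x = cls L c.
Proof. by move/K_cls. Qed.

(** Names an element of the cokernel by a ring element, via the identification with A/(L + aA) in
    which the formulas for beta, gamma and delta are given. *)
Definition ccls L (d : A) : C a L := coker_id (cls (addsm L (prid a)) d).

Lemma cclsP L (z : C a L) : exists d, z = ccls L d.
Proof.
have [y ->] := clsP z; have [d ->] := clsP y.
by exists d; rewrite /ccls coker_id_cls.
Qed.

Lemma ccls_lin L (b x y : A) : ccls L (b * x + y) = b *: ccls L x + ccls L y.
Proof.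
by rewrite /ccls cls_lin linearP.
Qed.

(** The identification [coker_id] is injective, so equality of classes is congruence modulo L +
    aA. *)
Lemma cclsE L (x y : A) :
  ccls L x = ccls L y <-> exists2 l, l \in L & exists b, x - y = l + a * b.
Proof.
rewrite /ccls; split=> [/(bij_inj (@coker_id_bij _ a L))/clsE/addsmP|].
  by move=> [l [m [lL /asboolP[b ->] e]]]; exists l => //; exists b.
move=> [l lL [b e]]; congr coker_id; apply/clsE/addsmP; exists l, (a * b).
by split=> //; apply/asboolP; exists b.
Qed.

Lemma ccls0 L (x : A) : ccls L x = 0 <-> exists2 l, l \in L & exists b, x = l + a * b.
Proof.
have <- : ccls L 0 = 0 by rewrite /ccls !raddf0.
by rewrite cclsE subr0.
Qed.

Lemma Kval_lin L (b : A) (x y : K a L) (c d : A) :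
  Kval x = cls L c -> Kval y = cls L d -> Kval (b *: x + y) = cls L (b * c + d).
Proof.
by move=> xc yd; rewrite linearP xc yd cls_lin.
Qed.

(** The inclusion of the kernel into A/L is injective, so vanishing can be tested on any
    representative. *)
Lemma Kval_eq0 L (x : K a L) (c : A) : Kval x = cls L c -> (x = 0 <-> c \in L).
Proof.
move=> xc; rewrite -cls0P -xc; split=> [->|x0]; first exact: raddf0.
by apply: Kval_inj; rewrite x0 raddf0.
Qed.

End KernelsAndCokernels.

(** * Construction of the five maps *)

Section ConnectingMaps.
Variables (A : comPzRingType) (a : A) (I J : ideal A).

Lemma eta_exists :
  exists eta : {linear K a (capsm I J) -> (K a I * K a J)%type},
  forall (x : K a (capsm I J)) (c : A), Kval x = cls (capsm I J) c ->
    Kval (eta x).1 = cls I c /\ Kval (eta x).2 = cls J c.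
Proof.
pose G (x : K a (capsm I J)) (u : K a I * K a J) := exists c : A,
  [/\ Kval x = cls (capsm I J) c, Kval u.1 = cls I c & Kval u.2 = cls J c].
have [x|b x y u v|u|eta etaE] := @linear_of_relation _ _ _ G.
- have [c xc /andP[acI acJ]] := K_rep x.
  have [y yc] := K_lift acI; have [z zc] := K_lift acJ.
  by exists (y, z), c.
- move=> [c [xc uc1 uc2]] [d [yd vd1 vd2]].
  by exists (b * c + d); split; apply: Kval_lin.
- move=> [c [/Kval_eq0[/(_ erefl)/andP[cI cJ] _]] u1 u2].
  rewrite [u]surjective_pairing; congr pair; first exact/(Kval_eq0 u1).
  exact/(Kval_eq0 u2).
(* The formula must hold for every representative, so the lifts are rebuilt from the given [c]. *)
exists eta => x c xc; have [acI acJ] := andP (K_mem xc).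
have [y yc] := K_lift acI; have [z zc] := K_lift acJ.
by rewrite (etaE x (y, z)) //; exists c.
Qed.

Lemma alpha_exists :
  exists alpha : {linear (K a I * K a J)%type -> K a (addsm I J)},
  forall (x : K a I) (y : K a J) (d b : A),
    Kval x = cls I d -> Kval y = cls J b ->
    Kval (alpha (x, y)) = cls (addsm I J) (d - b).
Proof.
pose G (x : K a I * K a J) (u : K a (addsm I J)) := exists d b : A,
  [/\ Kval x.1 = cls I d, Kval x.2 = cls J b & Kval u = cls (addsm I J) (d - b)].
(* Since ad lies in I and ab in J, a(d - b) lies in I + J. *)
have lift (x : K a I) (y : K a J) (d b : A) : Kval x = cls I d -> Kval y = cls J b ->
    exists u : K a (addsm I J), Kval u = cls (addsm I J) (d - b).
  move=> /K_mem adI /K_mem abJ; apply: K_lift; apply/addsmP.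
  by exists (a * d), (- (a * b)); rewrite mulrBr idealN.
have [[x y]|r x y u v|u|alpha alphaE] := @linear_of_relation _ _ _ G.
- have [d xd _] := K_rep x; have [b yb _] := K_rep y.
  by have [u ue] := lift _ _ _ _ xd yb; exists u, d, b.
- move=> [d [b [xd xb ud]]] [d' [b' [yd yb vd]]].
  exists (r * d + d'), (r * b + b'); split; [exact: Kval_lin..|].
  by rewrite (Kval_lin r ud vd) opprD addrACA mulrBr.
- move=> [d [b [/Kval_eq0[/(_ erefl) dI _] /Kval_eq0[/(_ erefl) bJ _] ud]]].
  by apply/(Kval_eq0 ud)/addsmP; exists d, (- b); rewrite idealN.
exists alpha => x y d b xd yb; have [u ue] := lift _ _ _ _ xd yb.
by rewrite (alphaE (x, y) u) //; exists d, b.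
Qed.

Lemma delta_exists :
  exists delta : {linear K a (addsm I J) -> C a (capsm I J)},
  forall (x : K a (addsm I J)) (c i j : A), Kval x = cls (addsm I J) c ->
    i \in I -> j \in J -> a * c = i + j -> delta x = ccls a (capsm I J) j.
Proof.
pose G (x : K a (addsm I J)) (u : C a (capsm I J)) := exists c i j : A,
  [/\ Kval x = cls (addsm I J) c, i \in I, j \in J, a * c = i + j
    & u = ccls a (capsm I J) j].
have [x|b x y u v|u|delta deltaE] := @linear_of_relation _ _ _ G.
- have [c xc /addsmP[i [j [iI jJ e]]]] := K_rep x.
  by exists (ccls a (capsm I J) j), c, i, j.
- move=> [c [i [j [xc iI jJ e ->]]]] [c' [i' [j' [yc iI' jJ' e' ->]]]].
  exists (b * c + c'), (b * i + i'), (b * j + j'); split.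
  + exact: Kval_lin.
  + by rewrite idealD // idealMl.
  + by rewrite idealD // idealMl.
  + by rewrite mulrDr mulrCA e e' mulrDr addrACA.
  + by rewrite ccls_lin.
- move=> [c [i [j [/Kval_eq0[/(_ erefl)/addsmP[i0 [j0 [iI0 jJ0 ce]]] _]]]]].
  (* With c = i0 + j0, the element j - a j0 of J equals a i0 - i, hence lies in I too; so j is in (I
     cap J) + aA. *)
  move=> iI jJ e ->; apply/ccls0; exists (j - a * j0); last first.
    by exists j0; rewrite subrK.
  have eq : j - a * j0 = a * i0 - i.
    apply/eqP; rewrite subr_eq addrAC -mulrDr -ce e.
    by rewrite [i + j]addrC addrK.
  by apply/andP; split; [rewrite eq|]; rewrite idealB ?idealMl.
by exists delta => x c i j xc iI jJ e; apply: deltaE; exists c, i, j.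
Qed.

Lemma beta_exists :
  exists beta : {linear C a (capsm I J) -> (C a I * C a J)%type},
  forall d : A, beta (ccls a (capsm I J) d) = (ccls a I d, ccls a J d).
Proof.
pose G (x : C a (capsm I J)) (u : C a I * C a J) := exists d : A,
  x = ccls a (capsm I J) d /\ u = (ccls a I d, ccls a J d).
have [x|b x y u v|u|beta betaE] := @linear_of_relation _ _ _ G.
- by have [d ->] := cclsP x; exists (ccls a I d, ccls a J d), d.
- move=> [d [-> ->]] [d' [-> ->]]; exists (b * d + d').
  by split; rewrite !ccls_lin.
- move=> [d [/esym/ccls0[l /andP[lI lJ] [b e]] ->]].
  by congr pair; apply/ccls0; exists l => //; exists b.
by exists beta => d; apply: betaE; exists d.
Qed.

Lemma gamma_exists :
  exists gamma : {linear (C a I * C a J)%type -> C a (addsm I J)},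
  forall d b : A, gamma (ccls a I d, ccls a J b) = ccls a (addsm I J) (d - b).
Proof.
pose G (x : C a I * C a J) (u : C a (addsm I J)) := exists d b : A,
  x = (ccls a I d, ccls a J b) /\ u = ccls a (addsm I J) (d - b).
have [[x y]|r x y u v|u|gamma gammaE] := @linear_of_relation _ _ _ G.
- have [d ->] := cclsP x; have [b ->] := cclsP y.
  by exists (ccls a (addsm I J) (d - b)), d, b.
- move=> [d [b [-> ->]]] [d' [b' [-> ->]]].
  exists (r * d + d'), (r * b + b'); rewrite !ccls_lin; split=> //.
  by rewrite -ccls_lin mulrBr opprD addrACA.
- move=> [d [b [[/esym/ccls0[l lI [s ->]] /esym/ccls0[m mJ [t ->]]] ->]]].
  apply/ccls0; exists (l - m).
    by apply/addsmP; exists l, (- m); rewrite idealN.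
  by exists (s - t); rewrite opprD addrACA mulrBr.
by exists gamma => d b; apply: gammaE; exists d, b.
Qed.

End ConnectingMaps.

(** * Exactness at the six places *)

Theorem theorem2p1 (A : comPzRingType) (I J : ideal A) (a : A) :
  exists (eta : {linear K a (capsm I J) -> (K a I * K a J)%type})
         (alpha : {linear (K a I * K a J)%type -> K a (addsm I J)})
         (delta : {linear K a (addsm I J) -> C a (capsm I J)})
         (beta : {linear C a (capsm I J) -> (C a I * C a J)%type})
         (gamma : {linear (C a I * C a J)%type -> C a (addsm I J)}),
  [/\ [/\ forall (x : K a (capsm I J)) (c : A), Kval x = cls (capsm I J) c ->
            Kval (eta x).1 = cls I c /\ Kval (eta x).2 = cls J c,
          forall (x : K a I) (y : K a J) (d b : A),
            Kval x = cls I d -> Kval y = cls J b ->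
            Kval (alpha (x, y)) = cls (addsm I J) (d - b),
          forall d : A,
            beta (coker_id (cls (addsm (capsm I J) (prid a)) d)) =
              (coker_id (cls (addsm I (prid a)) d), coker_id (cls (addsm J (prid a)) d)),
          forall d b : A,
            gamma (coker_id (cls (addsm I (prid a)) d), coker_id (cls (addsm J (prid a)) b)) =
              coker_id (cls (addsm (addsm I J) (prid a)) (d - b))
        & forall (x : K a (addsm I J)) (c i j : A), Kval x = cls (addsm I J) c ->
            i \in I -> j \in J -> a * c = i + j ->
            delta x = coker_id (cls (addsm (capsm I J) (prid a)) j)]
    & [/\ exact_at (\0 : {linear 'rV[A]_0 -> K a (capsm I J)}) eta,
          exact_at eta alpha,
          exact_at alpha delta
        & [/\ exact_at delta beta,
          exact_at beta gamma
        & exact_at gamma (\0 : {linear C a (addsm I J) -> 'rV[A]_0})]]].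
Proof.
have [eta etaE] := eta_exists a I J; have [alpha alphaE] := alpha_exists a I J.
have [delta deltaE] := delta_exists a I J.
have [beta betaE] := beta_exists a I J; have [gamma gammaE] := gamma_exists a I J.
exists eta, alpha, delta, beta, gamma.
split; first by split; [exact: etaE | exact: alphaE | exact: betaE | exact: gammaE
                       | exact: deltaE].
split; last split.
- apply: exact_atP => [u|x x0]; first exact: raddf0.
  (* The source is the zero module, so 0 is the only candidate preimage; [x] vanishes because its
     representative lies in both I and J. *)
  exists 0; apply/esym; have [c xc _] := K_rep x; apply/(Kval_eq0 xc).
  have [] := etaE _ _ xc; rewrite x0 !raddf0 => /esym/cls0P cI /esym/cls0P cJ.
  exact/andP.
- apply: exact_atP => [x|[x y] xy0].
    have [c xc _] := K_rep x; have [xI xJ] := etaE _ _ xc.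
    rewrite [eta x]surjective_pairing; apply/(Kval_eq0 (alphaE _ _ _ _ xI xJ)).
    by rewrite subrr ideal0.
  have [d xd adI] := K_rep x; have [b yb abJ] := K_rep y.
  have /Kval_eq0[/(_ xy0)/addsmP[i [j [iI jJ e]]] _] := alphaE _ _ _ _ xd yb.
  (* From d - b = i + j, the element d - i = b + j is congruent to d modulo I and to b modulo J, so
     it represents the preimage. *)
  have dib : d - i = b + j by apply/eqP; rewrite subr_eq addrAC -addrA -e addrC subrK.
  have [|z ze] := @K_lift _ a (capsm I J) (d - i).
    apply/andP; split; first by rewrite mulrBr idealB // idealMl.
    by rewrite dib mulrDr idealD // idealMl.
  exists z; have [z1 z2] := etaE _ _ ze; rewrite [eta z]surjective_pairing.
  congr pair; apply: Kval_inj; rewrite ?z1 ?z2 ?xd ?yb; apply/clsE.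
    by rewrite addrAC subrr sub0r idealN.
  by rewrite dib addrAC subrr add0r.
- apply: exact_atP => [[x y]|x x0].
    have [d xd adI] := K_rep x; have [b yb abJ] := K_rep y.
    (* The splitting a(d - b) = ad + (-ab) computes delta, and its J-part -ab lies in aA. *)
    rewrite (deltaE _ _ (a * d) (- (a * b)) (alphaE _ _ _ _ xd yb)) ?idealN ?mulrBr //.
    by apply/ccls0; exists 0; [rewrite ideal0 | exists (- b); rewrite mulrN add0r].
  have [c xc /addsmP[i [j [iI jJ e]]]] := K_rep x.
  have := deltaE _ _ _ _ xc iI jJ e; rewrite x0.
  move=> /esym/ccls0[k /andP[kI kJ] [b je]].
  (* Here j = k + ab with k in I cap J. Thus a(c - b) = i + k is in I and a(-b) = k - j is in J,
     while (c - b) - (-b) = c. *)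
  have [|y ye] := @K_lift _ a I (c - b).
    by rewrite mulrBr e je addrA addrK idealD.
  have [|z ze] := @K_lift _ a J (- b).
    by rewrite mulrN idealN -[a * b](addKr k) -je idealD ?idealN.
  exists (y, z); apply: Kval_inj.
  by rewrite (alphaE _ _ _ _ ye ze) opprK subrK xc.
- apply: exact_atP => [x|z].
    have [c xc /addsmP[i [j [iI jJ e]]]] := K_rep x.
    (* The class of j dies modulo I + aA because j = -i + ac, and modulo J + aA because j is in
       J. *)
    rewrite (deltaE _ _ _ _ xc iI jJ e) betaE; congr pair; apply/ccls0.
      by exists (- i); [rewrite idealN | exists c; rewrite e addKr].
    by exists j => //; exists 0; rewrite mulr0 addr0.
  have [d ->] := cclsP z; rewrite betaE.
  move=> [/ccls0[i iI [s ds]] /ccls0[j jJ [t dt]]].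
  (* Comparing d = i + as with d = j + at shows that s - t lies in the kernel for I + J; delta sends
     it to j, which differs from d by -at. *)
  have e : a * (s - t) = - i + j.
    by rewrite mulrBr; apply/eqP; rewrite subr_eq -addrA -dt ds addKr.
  have [|x xe] := @K_lift _ a (addsm I J) (s - t).
    by apply/addsmP; exists (- i), j; rewrite idealN.
  exists x; rewrite (deltaE _ _ (- i) j xe) ?idealN //; apply/cclsE.
  exists 0; first exact: ideal0.
  by exists (- t); rewrite dt opprD addrA subrr mulrN.
- apply: exact_atP => [z|[x y]].
    have [d ->] := cclsP z; rewrite betaE gammaE subrr.
    by apply/ccls0; exists 0; [rewrite ideal0 | exists 0; rewrite mulr0 addr0].
  have [d ->] := cclsP x; have [b ->] := cclsP y; rewrite gammaE.
  move=> /ccls0[_ /addsmP[i [j [iI jJ ->]]] [s e]].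
  (* The preimage is again d - i: it agrees with d modulo I, and with b modulo J + aA. *)
  have dib : d - i = b + j + a * s.
    by apply/eqP; rewrite subr_eq -(subrK b d) e; apply/eqP; ring.
  exists (ccls a (capsm I J) (d - i)); rewrite betaE; congr pair; apply/cclsE.
    exists (- i); first by rewrite idealN.
    by exists 0; ring.
  by exists j => //; exists s; rewrite dib; ring.
- apply: exact_atP => [x|z _]; first exact: raddf0.
  (* Surjectivity of gamma: the class of d is the image of the pair (d, 0). *)
  have [d ->] := cclsP z; exists (ccls a I d, ccls a J 0).
  by rewrite gammaE subr0.
Qed.
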